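(* Let $\alpha,\beta,\gamma,\delta$ be the sector angles of a spherical 4-bar linkage, and let $u,v$ be the spherical lengths of the two diagonals in some configuration of the linkage, $u$ being the diagonal that closes the spherical triangles $(\alpha,\beta,u)$ and $(\gamma,\delta,u)$, and $v$ the diagonal that closes the spherical triangles $(\beta,\gamma,v)$ and $(\delta,\alpha,v)$. Then $$(1-\cos u)^2(1-\cos v)^2-2(1-\cos u)^2(1-\cos v)-2(1-\cos u)(1-\cos v)^2+h_{11}(1-\cos u)(1-\cos v)+h_{10}(1-\cos u)+h_{01}(1-\cos v)+h_{00}=0,$$ where $$h_{11}=2(2-\cos\alpha\cos\gamma-\cos\beta\cos\delta),\quad h_{10}=2(\cos\beta-\cos\gamma)(\cos\delta-\cos\alpha),\quad h_{01}=2(\cos\alpha-\cos\beta)(\cos\gamma-\cos\delta),$$ $$h_{00}=(\cos\alpha\cos\gamma-\cos\beta\cos\delta)^2-(\cos\alpha-\cos\beta+\cos\gamma-\cos\delta)^2,$$ and moreover $h_{00}=\big((1-\cos\alpha)(1-\cos\gamma)-(1-\cos\beta)(1-\cos\delta)\big)\big((1+\cos\alpha)(1+\cos\gamma)-(1+\cos\beta)(1+\cos\delta)\big)$.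
   Context: A spherical 4-bar linkage with sector angles $\alpha,\beta,\gamma,\delta\in(0,\pi)$ in a given configuration consists of four unit vectors $p_w,p_x,p_y,p_z\in\mathbb{R}^3$ with angular distances $\angle(p_w,p_x)=\alpha$, $\angle(p_x,p_y)=\beta$, $\angle(p_y,p_z)=\gamma$, $\angle(p_z,p_w)=\delta$. The diagonals have spherical lengths $u=\angle(p_w,p_y)\in[0,\pi]$ and $v=\angle(p_x,p_z)\in[0,\pi]$. *)

(* Defs.v *)
From mathcomp Require Import all_boot all_order all_algebra.
From mathcomp Require Import reals trigo.

Set Implicit Arguments.
Unset Strict Implicit.
Unset Printing Implicit Defensive.

Import Order.TTheory GRing.Theory Num.Theory.

Local Open Scope ring_scope.

Section SphericalFourBar.
Variable R : realType.
Implicit Types (p q : 'rV[R]_3) (alpha beta gamma delta : R).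

Definition dot p q : R := \sum_i p 0 i * q 0 i.

(* Euclidean length one; the library norm on row vectors is the sup norm. *)
Definition unit_vector p : Prop := Num.sqrt (dot p p) = 1.

(* The angle between unit vectors, in [0, pi]; the value is meaningful only
   when [p] and [q] are unit vectors, so that [dot p q] lies in [-1, 1]. *)
Definition sph_dist p q : R := acos (dot p q).

Definition sector_angle (a : R) : Prop := 0 < a < pi.

(* The vertices are listed in cyclic order, so the bars are wx, xy, yz, zw and
   the diagonals are wy and xz.  No genericity is imposed: bars may be
   collinear, and opposite vertices may coincide or be antipodal. *)
Record linkage_configuration alpha beta gamma delta
    (pw px py pz : 'rV[R]_3) : Prop := LinkageConfiguration {
  config_unit_w : unit_vector pw;
  config_unit_x : unit_vector px;
  config_unit_y : unit_vector py;
  config_unit_z : unit_vector pz;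
  config_wx : sph_dist pw px = alpha;
  config_xy : sph_dist px py = beta;
  config_yz : sph_dist py pz = gamma;
  config_zw : sph_dist pz pw = delta
}.

Definition h11 alpha beta gamma delta : R :=
  2 * (2 - cos alpha * cos gamma - cos beta * cos delta).

Definition h10 alpha beta gamma delta : R :=
  2 * (cos beta - cos gamma) * (cos delta - cos alpha).

Definition h01 alpha beta gamma delta : R :=
  2 * (cos alpha - cos beta) * (cos gamma - cos delta).

Definition h00 alpha beta gamma delta : R :=
  (cos alpha * cos gamma - cos beta * cos delta) ^+ 2
  - (cos alpha - cos beta + cos gamma - cos delta) ^+ 2.

End SphericalFourBar.

(* Main.v *)
Require Import Defs.
From mathcomp Require Import all_boot all_order all_algebra.
From mathcomp Require Import reals trigo.
From mathcomp Require Import ring lra.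
Import Order.TTheory GRing.Theory Num.Theory.
Local Open Scope ring_scope.

(* The vertices are four vectors of a three-dimensional space, so their 4 x 4
   Gram determinant vanishes.  Its diagonal entries are 1 and its other entries
   are the cosines of the bars and diagonals; expanded in powers of 1 - cos u
   and 1 - cos v it is exactly the polynomial of the theorem. *)

(** Laplace expansion along the top rows: [m2] and [m3] are the minors on the last two and last
    three rows. Entries are indexed by [nat] so that the lifted column indices compute to
    numerals. *)
Lemma det_mx44 (R : comNzRingType) (A : nat -> nat -> R) :
  \det (\matrix_(i < 4, j < 4) A i j) =
  let m2 i j := A 2%N i * A 3%N j - A 2%N j * A 3%N i in
  let m3 i j k := A 1%N i * m2 j k - A 1%N j * m2 i k + A 1%N k * m2 i j in
  A 0%N 0%N * m3 1%N 2%N 3%N - A 0%N 1%N * m3 0%N 2%N 3%N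
  + A 0%N 2%N * m3 0%N 1%N 3%N - A 0%N 3%N * m3 0%N 1%N 2%N.
Proof.
rewrite (expand_det_row _ ord0) !big_ord_recl big_ord0 /cofactor.
rewrite !(@expand_det_row _ 3 _ ord0) !big_ord_recl !big_ord0 /cofactor.
rewrite !(@expand_det_row _ 2 _ ord0) !big_ord_recl !big_ord0 /cofactor.
rewrite !det_mx11 !mxE /bump /=.
ring.
Qed.

(** The product factors through a space of dimension [n], so its rank is at most [n], too small for
    an invertible matrix of size [m]. *)
Lemma det_gram_eq0 (F : fieldType) (m n : nat) (M : 'M[F]_(m, n)) :
  (n < m)%N -> \det (M *m M^T) = 0.
Proof.
move=> nm; apply/eqP; apply: contraTT nm => det_neq0.
have : M *m M^T \in unitmx by rewrite unitmxE unitfE.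
rewrite -leqNgt => /mxrank_unit <-.
exact: leq_trans (mxrankM_maxl _ _) (rank_leq_col _).
Qed.

Section Dot.
Variable R : realType.
Implicit Types p q : 'rV[R]_3.

Lemma dotC p q : dot p q = dot q p.
Proof. by apply: eq_bigr => i _; rewrite mulrC. Qed.

Lemma dot_unit_vector p : unit_vector p -> dot p p = 1.
Proof.
rewrite /unit_vector => sqrt1.
rewrite -[LHS]sqr_sqrtr ?sqrt1 ?expr1n //.
by apply: sumr_ge0 => i _; rewrite -expr2 sqr_ge0.
Qed.

Lemma cos_sph_dist p q :
  unit_vector p -> unit_vector q -> cos (sph_dist p q) = dot p q.
Proof.
move=> /dot_unit_vector pp /dot_unit_vector qq; rewrite /sph_dist acosK //.
(* For [s] equal to 1 or -1 this is the squared length of [p + s q]; the two signs bound [dot p q]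
   by -1 and 1, the range on which [cos] inverts [acos]. *)
have normD (s : R) : s ^+ 2 = 1 -> 0 <= 2 + 2 * s * dot p q.
  move=> s2; have -> : 2 + 2 * s * dot p q = \sum_i (p 0 i + s * q 0 i) ^+ 2.
    transitivity (dot p p + s ^+ 2 * dot q q + 2 * s * dot p q).
      by rewrite pp qq s2; ring.
    rewrite /dot !mulr_sumr -!big_split /=.
    by apply: eq_bigr => i _; ring.
  by apply: sumr_ge0 => i _; rewrite sqr_ge0.
have := normD 1 (expr1n _ _); have := normD (-1) (sqrr_sign R 1).
by rewrite in_itv /=; lra.
Qed.

Lemma dot_gram_eq0 (p : nat -> 'rV[R]_3) :
  \det (\matrix_(i < 4, j < 4) dot (p i) (p j)) = 0.
Proof.
rewrite -(@det_gram_eq0 _ 4 3 (\matrix_(i < 4) p i)) //; congr (\det _).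
by apply/matrixP => i j; rewrite !mxE; apply: eq_bigr => k _; rewrite !mxE.
Qed.

End Dot.

Theorem mainTheorem1 (R : realType) (alpha beta gamma delta : R)
    (halpha : sector_angle alpha) (hbeta : sector_angle beta)
    (hgamma : sector_angle gamma) (hdelta : sector_angle delta)
    (pw px py pz : 'rV[R]_3)
    (hconf : linkage_configuration alpha beta gamma delta pw px py pz)
    (u v : R) (hu : u = sph_dist pw py) (hv : v = sph_dist px pz) :
  (1 - cos u) ^+ 2 * (1 - cos v) ^+ 2
    - 2 * (1 - cos u) ^+ 2 * (1 - cos v)
    - 2 * (1 - cos u) * (1 - cos v) ^+ 2
    + h11 alpha beta gamma delta * (1 - cos u) * (1 - cos v)
    + h10 alpha beta gamma delta * (1 - cos u)
    + h01 alpha beta gamma delta * (1 - cos v)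
    + h00 alpha beta gamma delta = 0
  /\
  h00 alpha beta gamma delta =
    ((1 - cos alpha) * (1 - cos gamma) - (1 - cos beta) * (1 - cos delta))
    * ((1 + cos alpha) * (1 + cos gamma) - (1 + cos beta) * (1 + cos delta)).
Proof.
split; last by rewrite /h00; ring.
case: hconf => uw ux uy uz <- <- <- <-.
rewrite hu hv /h11 /h10 /h01 /h00 !cos_sph_dist //.
(* The default value [pz] of [nth] serves as the fourth vertex, at index 3. *)
pose p := nth pz [:: pw; px; py].
have := dot_gram_eq0 _ p; rewrite (det_mx44 _ (fun i j => dot (p i) (p j))) /=.
(* Symmetry leaves six inner products, oriented as in the bars and diagonals, so that the goal and
   the Gram determinant are polynomials in the same atoms. *)
rewrite !dot_unit_vector // (dotC _ px pw) (dotC _ py pw) (dotC _ py px).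
rewrite (dotC _ pw pz) (dotC _ pz px) (dotC _ pz py) => gram0.
by rewrite -[RHS]gram0; ring.
Qed.
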